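(* The spectral measure $\nu_{\rho_1}$ (over $\chi_{\rho_1}(\mathbb{T}^2)=[-4,4]$) for the graph $\mathcal{G}^{D_4^{(2)}}_{\rho_1}$ for $SO(4)$ is given by $$\mathrm{d}\nu_{\rho_1}(x)=\frac{1}{2\pi^2|x|}\left((x^2+16)\,K\!\left(\frac{x^2-16}{x^2}\right)-2x^2\,E\!\left(\frac{x^2-16}{x^2}\right)\right)\mathrm{d}x.$$
   Context: $K(m)=\int_0^{\pi/2}(1-m\sin^2\theta)^{-1/2}\,\mathrm{d}\theta$ and $E(m)=\int_0^{\pi/2}(1-m\sin^2\theta)^{1/2}\,\mathrm{d}\theta$ are the complete elliptic integrals of the first and second kind as functions of the parameter $m$ (here $m\le0$). Let $P_+=\{\lambda\in\mathbb{Z}^2:\lambda_1\ge|\lambda_2|\}$. For $\lambda\in\mathbb{Z}^2$ put $S_\lambda=\omega_1^{\lambda_1}\omega_2^{\lambda_2}+\omega_1^{-\lambda_1}\omega_2^{-\lambda_2}-\omega_1^{\lambda_2}\omega_2^{\lambda_1}-\omega_1^{-\lambda_2}\omega_2^{-\lambda_1}$, and for $\lambda\in P_+$ let $\chi_\lambda=S_{\lambda+(1,0)}/S_{(1,0)}$ (the irreducible characters of $SO(4)$ on its maximal torus $\mathbb{T}^2$; its Weyl group is $D_4^{(2)}=\langle -I,\begin{pmatrix}0&1\\1&0\end{pmatrix}\rangle$). Put $\rho_1=(1,0)$, so $\chi_{\rho_1}=\omega_1+\omega_1^{-1}+\omega_2+\omega_2^{-1}$. The graph $\mathcal{G}^{D_4^{(2)}}_{\rho_1}$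 has vertex set $P_+$ and $m_{\mu\nu}$ edges from $\mu$ to $\nu$, where $\chi_{\rho_1}\chi_\mu=\sum_\nu m_{\mu\nu}\chi_\nu$; its adjacency operator $\Delta_{\rho_1}$ on $\ell^2(P_+)$ is self-adjoint. The distinguished vertex is $\ast=(0,0)$, the unique vertex with only one edge attached. The spectral measure $\nu_{\rho_1}$ is the unique compactly supported probability measure with $\langle\Delta_{\rho_1}^m\delta_\ast,\delta_\ast\rangle=\int t^m\,\mathrm{d}\nu_{\rho_1}(t)$ for all integers $m\ge0$. *)

(* Defs.v *)
From HB Require Import structures.
From mathcomp Require Import all_boot all_order all_algebra.
From mathcomp Require Import complex ring.
From mathcomp Require Import all_classical all_reals all_analysis.
From mathcomp.analysis.showcase Require summability.

Set Implicit Arguments.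
Unset Strict Implicit.
Unset Printing Implicit Defensive.

Import Order.TTheory GRing.Theory Num.Theory.
Import numFieldNormedType.Exports.

Local Open Scope classical_set_scope.
Local Open Scope ring_scope.

Section EllipticIntegrals.
Context {R : realType}.
Implicit Types m : R.

(* The argument is the parameter m, not the modulus k with m = k ^+ 2. *)
Definition ellipticK m : R :=
  \int[lebesgue_measure]_(t in `[0, pi / 2]) (Num.sqrt (1 - m * sin t ^+ 2))^-1.

Definition ellipticE m : R :=
  \int[lebesgue_measure]_(t in `[0, pi / 2]) Num.sqrt (1 - m * sin t ^+ 2).

End EllipticIntegrals.

Definition Pplus := {l : int * int | `|l.2| <= l.1}.

Definition star : Pplus := exist _ (0, 0) (lexx (0 : int)).

Definition rho1 : int * int := (1, 0).

Section Characters.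
Context {R : realType}.
Implicit Types (l : int * int) (w : R[i] * R[i]).

Definition torus2 : set (R[i] * R[i]) := [set w | `|w.1| = 1 /\ `|w.2| = 1].

Definition Salt l w : R[i] :=
  w.1 ^ l.1 * w.2 ^ l.2 + w.1 ^ (- l.1) * w.2 ^ (- l.2)
  - w.1 ^ l.2 * w.2 ^ l.1 - w.1 ^ (- l.2) * w.2 ^ (- l.1).

(* The quotient gives the value of the character only where Salt rho1 w != 0,
   which is a dense open subset of the torus. *)
Definition chi l w : R[i] := Salt (l + rho1) w / Salt rho1 w.

(* The character of rho1 on the whole torus, zeros of Salt rho1 included. *)
Definition chi_rho1 w : R[i] := w.1 + w.1^-1 + w.2 + w.2^-1.

Lemma chi_rho1E w : torus2 w -> Salt rho1 w != 0 -> chi rho1 w = chi_rho1 w.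
Proof.
case: w => a b [/= na nb] S0.
have a0 : a != 0 by rewrite -normr_eq0 na oner_neq0.
have b0 : b != 0 by rewrite -normr_eq0 nb oner_neq0.
apply: (mulIf S0); rewrite /chi divfK // /chi_rho1 /Salt /=.
have -> : (1 + 1 : int) = 2%N by [].
rewrite !addr0 !oppr0 !expr0z -!invr_expz !expr1z -!exprnP.
by field; rewrite a0 b0.
Qed.

(* Characters are continuous, so equality where Salt rho1 does not vanish is
   equality on the whole torus. *)
Definition decomposes (mu : Pplus) (c : Pplus -> nat) : Prop :=
  finite_set [set nu | c nu != 0%N] /\
  forall w, torus2 w -> Salt rho1 w != 0 ->
    chi_rho1 w * chi (val mu) w
    = \sum_(nu \in [set: Pplus]) (c nu)%:R * chi (val nu) w.

(* The irreducible characters are linearly independent: at most one c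
   decomposes chi_rho1 * chi mu. *)
Definition edges (mu : Pplus) : Pplus -> nat :=
  xget (fun=> 0%N) [set c | decomposes mu c].

(* Vectors of l^2(Pplus) are functions Pplus -> R[i]. The formula makes sense
   for all functions, since finitely many edges leave each vertex; the number
   of edges at a vertex is bounded, so l^2(Pplus) is stable under it. *)
Definition adjacency (f : Pplus -> R[i]) : Pplus -> R[i] :=
  fun mu => \sum_(nu \in [set: Pplus]) (edges mu nu)%:R * f nu.

Definition delta (mu : Pplus) : Pplus -> R[i] := fun nu => (nu == mu)%:R.

(* summability.sum is the limit of the sums over finite subsets of Pplus. *)
Definition ell2_dot (f g : Pplus -> R[i]) : R[i] :=
  summability.sum (fun v => (f v * (g v)^*%C : R[i]^o)).

Definition is_spectral_measure (nu : probability (measurableTypeR R) R) : Prop :=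
  (exists2 K : set R, compact K & nu (~` K) = 0%E) /\
  forall m : nat, ell2_dot (iter m adjacency (delta star)) (delta star)
    = (\int[nu]_t t ^+ m)%:C%C.

End Characters.

Arguments edges R mu _ : clear implicits.

(* Main.v *)
Require Import Defs.
From HB Require Import structures.
From mathcomp Require Import all_boot all_order all_algebra.
From mathcomp Require Import complex ring lra zify.
From mathcomp Require Import all_classical all_reals all_analysis measurable_realfun.
Import Order.TTheory GRing.Theory Num.Theory.
Import numFieldNormedType.Exports.
Local Open Scope classical_set_scope.
Local Open Scope ring_scope.

(** Put [p = l.1 + l.2] and [q = l.1 - l.2]; substituting [w = (a b, a / b)]
factors [Salt l] as [(a^p - a^-p) (b^q - b^-q)], which is how SO(4) comes from
SU(2) x SU(2). Hence multiplying by [chi_rho1] moves [l] to its four neighbours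
(terms on the walls vanish), and linear independence of the [Salt l] leaves no
other decomposition. The closed walks at [star] of length [m] are pairs of
closed walks on the half-line, so the [m]-th moment is the square of the [m]-th
moment [(2 / pi) \int_0^pi (2 cos t)^m sin^2 t dt] of the semicircle law: the
measure sought is the law of the product of two independent semicircular
variables. Its density is [(1 / (2 pi^2)) \int_{x/2}^2
sqrt ((4 - s^2) (4 s^2 - x^2)) / s^2 ds] for [0 < x < 4]. With
[D = sqrt (x^2 cos^2 t + 16 sin^2 t)], the substitution [s = D / 2] turns this
into [((16 - x^2)^2 / (2 pi^2)) \int_0^{pi/2} (sin t cos t)^2 / D^3 dt], and
integrating the derivative of [sin t cos t / D] turns that into the combination
of K and E. Finally, moments determine a compactly supported probability
measure, since the indicator of a ray is a bounded pointwise limit of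
polynomials there. *)

(** * Evaluation on the torus *)

Lemma normC1_Re {R : realType} (z : R[i]) : `|z| = 1 -> -1 <= complex.Re z <= 1.
Proof. by move=> z1; rewrite -ler_norml -lecR rmorph1 -z1 normc_ge_Re. Qed.

(** A nonzero polynomial has fewer roots than its size, while the points of the circle with real
    parts [1 / (n + 1)] are pairwise distinct. *)
Lemma poly_circle_eq0 {R : realType} (p : {poly R[i]}) :
  (forall z, `|z| = 1 -> p.[z] = 0) -> p = 0.
Proof.
move=> p0; apply/eqP/negPn/negP => pn0.
pose x n : R := n.+1%:R^-1.
pose z n : R[i] := (x n +i* Num.sqrt (1 - x n ^+ 2))%C.
have x01 n : 0 <= x n <= 1 by rewrite invr_ge0 ler0n invf_le1 ?ler1n// ltr0n.
have z1 n : `|z n| = 1.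
  rewrite normc_def /= sqr_sqrtr; last by have := x01 n; nra.
  by rewrite addrCA subrr addr0 sqrtr1.
have := @max_poly_roots _ p (mkseq z (size p)) pn0.
rewrite size_mkseq ltnn; case/(_ _ _)/negP => //.
  by apply/allP => _ /mapP[n _ ->]; apply/rootP/p0.
apply/mkseq_uniq => m n /(congr1 (@complex.Re R)) /= /invr_inj/eqP.
by rewrite eqr_nat => /eqP[].
Qed.

(** The one-variable case is used twice: with the inner variable frozen at [z], the outer polynomial
    is 0; so each coefficient vanishes at every [z] of the circle. *)
Lemma poly2_circle_eq0 {R : realType} (P : {poly {poly R[i]}}) :
  (forall w, torus2 w -> P.[w.1%:P].[w.2] = 0) -> P = 0.
Proof.
move=> P0; apply/polyP => i; rewrite coef0; apply: poly_circle_eq0 => z z1.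
have : map_poly (horner_eval z) P = 0.
  apply: poly_circle_eq0 => w w1.
  have -> : w = horner_eval z w%:P by rewrite /horner_eval hornerC.
  by rewrite horner_map; exact: (P0 (w, z)).
by move/(congr1 (fun q : {poly R[i]} => q`_i)); rewrite coef_map coef0.
Qed.

Lemma normC1_inv {R : realType} (z : R[i]) : `|z| = 1 -> z^-1 = z^*%C.
Proof.
move=> z1.
have z0 : z != 0 by rewrite -normr_eq0 z1 oner_neq0.
apply: (mulfI z0); rewrite mulfV //.
by have := sqr_normc z; rewrite z1 expr1n.
Qed.

Lemma chi_rho1_image {R : realType} :
  @chi_rho1 R @` torus2 = (fun x : R => x%:C%C) @` `[-4, 4].
Proof.
apply/seteqP; split.
  (* On the circle the inverse is the conjugate, so [chi_rho1] is twice the sum of the real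
     parts. *)
  move=> _ [[a b] [/= a1 b1] <-]; exists (2 * (complex.Re a + complex.Re b)).
    have := normC1_Re _ a1; have := normC1_Re _ b1.
    by rewrite /= in_itv /=; lra.
  rewrite /chi_rho1 /= (normC1_inv _ a1) (normC1_inv _ b1).
  case: a b {a1 b1} => [a a'] [b b'].
  by apply/eqP; rewrite eq_complex /=; apply/andP; split; apply/eqP; ring.
move=> _ [x + <-]; rewrite /= in_itv /= => x4.
(* The diagonal already attains every value: [chi_rho1 (z, z)] is four times the real part of
   [z]. *)
pose z := (x / 4 +i* Num.sqrt (1 - (x / 4) ^+ 2))%C.
have z1 : `|z| = 1.
  rewrite /z normc_def /= sqr_sqrtr; last by nra.
  by rewrite addrCA subrr addr0 sqrtr1.
exists (z, z); first by [].
rewrite /chi_rho1 /= (normC1_inv _ z1).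
by apply/eqP; rewrite eq_complex /=; apply/andP; split; apply/eqP; field.
Qed.

(* The coefficient of [Salt (nu0 + rho1)] is read off as that of the monomial of
   [nu0 + rho1], the only one of its four exponents lying inside [Pplus]. *)
Lemma sumS_free {R : realType} (s : seq Pplus) (d : Pplus -> R[i]) :
  uniq s ->
  (forall w, torus2 w -> \sum_(nu <- s) d nu * Salt (val nu + rho1) w = 0) ->
  forall nu, nu \in s -> d nu = 0.
Proof.
move=> us d0 nu0 nu0s.
pose B : nat := \max_(nu <- s) `|(val nu).1|.+1%N.
have Bge nu : nu \in s -> `|(val nu).2| <= (val nu).1 /\ (val nu).1 + 1 <= B%:Z.
  move=> nus; have : (`|(val nu).1|.+1 <= B)%N.
    exact: (leq_bigmax_seq (F := fun nu : Pplus => `|(val nu).1|.+1%N)).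
  have := valP nu; case: (val nu) => x y /= ; move: B => B ? ?; split; lia.
clearbody B.
(* All exponents are at most [B] in absolute value, so multiplying by [w.1 ^ B * w.2 ^ B] turns the
   Laurent polynomials into polynomials; [ix] is the shifted exponent. *)
pose ix (x : int) := absz (B%:Z + x).
pose M (e : int * int) : {poly {poly R[i]}} :=
  ('X^(ix e.2))%:P * 'X^(ix e.1).
have hM w e : torus2 w -> `|e.1| <= B%:Z -> `|e.2| <= B%:Z ->
    (M e).[w.1%:P].[w.2] = w.1 ^ (B%:Z + e.1) * w.2 ^ (B%:Z + e.2).
  case: e => x y /= _ e1 e2;
  rewrite /M hornerM hornerC hornerXn -rmorphXn/= hornerM hornerXn.
  by rewrite hornerC mulrC !exprnP /ix !gez0_abs//; lia.
have cM e i j : (M e)`_i`_j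
    = ((i == (ix e.1)) && (j == (ix e.2)))%:R.
  rewrite /M coefCM coefXn; case: eqP => /= _; last by rewrite mulr0 coef0.
  by rewrite mulr1 coefXn.
pose N (l : int * int) : {poly {poly R[i]}} :=
  M l + M (- l.1, - l.2) - M (l.2, l.1) - M (- l.2, - l.1).
pose P := \sum_(nu <- s) (d nu)%:P%:P * N (val nu + rho1).
have P0 : P = 0.
  apply: poly2_circle_eq0 => w w1.
  have [a0 b0] : w.1 != 0 /\ w.2 != 0.
    by case: w1 => w1 w2; split; rewrite -normr_eq0 ?w1 ?w2 oner_neq0.
  rewrite /P !horner_sum.
  rewrite (eq_big_seq (fun nu => w.1 ^ B%:Z * w.2 ^ B%:Z *
      (d nu * Salt (val nu + rho1) w))); last first.
    move=> nu /Bge[nu1 nu2].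
    have [l1 l2] : `|(val nu + rho1).1| <= B%:Z /\ `|(val nu + rho1).2| <= B%:Z.
      by move: (val nu) nu1 nu2 => [x y] /= ? ?; split; lia.
    move: (val nu + rho1) l1 l2 => [x y] /= l1 l2.
    rewrite /N !hornerM !hornerC !hornerD !hornerN !hM//= ?normrN//.
    rewrite /Salt /= !expfzDr//.
    move: (w.1 ^ B) (w.2 ^ B) => *.
    move: (w.1 ^ x) (w.1 ^ y) (w.1 ^ (- x)) (w.1 ^ (- y)) => *.
    move: (w.2 ^ x) (w.2 ^ y) (w.2 ^ (- x)) (w.2 ^ (- y)) => *.
    by ring.
  by rewrite -mulr_sumr d0 ?mulr0.
have sign4 (b1 b2 b3 b4 b : bool) : b1 = b -> b2 = false -> b3 = false ->
    b4 = false -> b1%:R + b2%:R - b3%:R - b4%:R = b%:R :> R[i].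
  by move=> -> -> -> ->; rewrite addr0 !subr0.
have cS nu : nu \in s -> let l := val nu + rho1 in let l0 := val nu0 + rho1 in
    (N l)`_(ix l0.1)`_(ix l0.2) = (nu == nu0)%:R.
  move=> nus; have := Bge _ nu0s; have := Bge _ nus; rewrite -val_eqE.
  have := valP nu0; have := valP nu.
  move: (val nu) (val nu0) => [x y] [x0 y0] /= nu1 nu01 H H0.
  rewrite /N !(coefB, coefD) !cM /ix /=.
  by apply: sign4; rewrite ?xpair_eqE; clear -H H0 nu1 nu01; lia.
pose l0 := val nu0 + rho1.
have : P`_(ix l0.1)`_(ix l0.2) = 0 by rewrite P0 !coef0.
rewrite /P !coef_sum (bigD1_seq nu0)// big1_seq ?addr0.
  by rewrite !coefCM [X in _ * X](cS nu0 nu0s) eqxx mulr1 /= addr0.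
move=> nu /andP[nn0 nus]; rewrite !coefCM.
by rewrite [X in _ * X](cS nu nus) (negbTE nn0) mulr0.
Qed.

(** * The graph and its closed walks *)

Definition dirs : seq (int * int) := [:: (1, 0); (-1, 0); (0, 1); (0, -1)].

(** [insub] discards the translates outside [Pplus]; their alternating sums vanish. *)
Definition nbrs (mu : Pplus) : seq Pplus :=
  pmap insub [seq val mu + e | e <- dirs].

(** [Salt] changes sign under [(x, y) -> (y, x)] and under [(x, y) -> (-y, -x)], and a wall point is
    fixed by one of the two. *)
Lemma Salt_wall {R : realType} (l : int * int) (w : R[i] * R[i]) :
  `|l.2| = l.1 -> Salt l w = 0.
Proof.
case: l => x y /= xy; have [->|->] : y = x \/ y = - x by lia.
  by rewrite /Salt /=; ring.
by rewrite /Salt /= opprK; ring.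
Qed.

(** The denominator factors as [(a - b) (1 - 1 / (a b))], and on either zero locus the four
    monomials of any [Salt l] cancel in pairs. Identities between alternating sums thus extend to
    the whole torus without a continuity argument. *)
Lemma Salt_singular {R : realType} (l : int * int) (w : R[i] * R[i]) :
  torus2 w -> Salt rho1 w = 0 -> Salt l w = 0.
Proof.
case: w => a b [/= a1 b1].
have a0 : a != 0 by rewrite -normr_eq0 a1 oner_neq0.
have b0 : b != 0 by rewrite -normr_eq0 b1 oner_neq0.
have -> : Salt rho1 (a, b) = (a - b) * (1 - (a * b)^-1).
  rewrite /Salt /= !oppr0 !expr0z !exprN1 !expr1z; by field; rewrite a0 b0.
move/eqP; rewrite mulf_eq0 !subr_eq0 => /orP[/eqP ->|/eqP ab].
  by rewrite /Salt /=; ring.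
have -> : b = a^-1 by apply: (mulfI a0); rewrite mulfV// -[LHS]invrK -ab invr1.
rewrite /Salt /= !exprz_inv !opprK; ring.
Qed.

(** The exponents of [chi_rho1] are [dirs], a set stable under the Weyl group, so multiplying an
    alternating sum by it translates the index. *)
Lemma chi_rho1_Salt {R : realType} (l : int * int) (w : R[i] * R[i]) :
  torus2 w -> chi_rho1 w * Salt l w = \sum_(e <- dirs) Salt (l + e) w.
Proof.
case: w l => a b [x y] [/= a1 b1].
have a0 : a != 0 by rewrite -normr_eq0 a1 oner_neq0.
have b0 : b != 0 by rewrite -normr_eq0 b1 oner_neq0.
rewrite !big_cons big_nil /Salt /chi_rho1 /= !addr0 !opprD !opprK !expfzDr//.
rewrite !exprN1 !expr1z ?oppr0 ?addr0.
move: (a ^ x) (a ^ y) (a ^ (- x)) (a ^ (- y)) => *.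
move: (b ^ x) (b ^ y) (b ^ (- x)) (b ^ (- y)) => *.
by ring.
Qed.

Lemma uniq_nbrs mu : uniq (nbrs mu).
Proof.
apply: pmap_sub_uniq; rewrite map_inj_uniq//; exact: addrI.
Qed.

Lemma sum_nbrs {R : realType} mu (F : Pplus -> R[i]) :
  \sum_(nu \in [set: Pplus]) (nu \in nbrs mu)%:R * F nu
  = \sum_(e <- dirs) oapp F 0 (insub (val mu + e)).
Proof.
rewrite -(fsbig_widen [set` nbrs mu])//; last first.
  by move=> nu /= [_ /negP/negbTE ->]; rewrite mul0r.
rewrite -fsbig_seq ?uniq_nbrs// (eq_big_seq F) ?big_pmap ?big_map//.
by move=> nu /= ->; rewrite mul1r.
Qed.

Lemma decomposes_nbrs {R : realType} mu :
  @decomposes R mu (fun nu => (nu \in nbrs mu) : nat).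
Proof.
split.
  apply: (@sub_finite_set _ _ [set` nbrs mu]); last exact: finite_seq.
  by move=> nu /=; case: (nu \in _).
move=> w w1 S0; rewrite sum_nbrs /chi mulrA chi_rho1_Salt// mulr_suml.
apply: eq_big_seq => e edirs; case: insubP => /= [nu _ ->|].
  by congr (Salt _ w / _); rewrite addrAC.
(* A unit step out of [Pplus] lands, after the shift by [rho1], exactly on a wall. *)
move=> Nmue; rewrite Salt_wall ?mul0r//; move: Nmue edirs.
case: mu => [[x y] /= xy]; rewrite !inE.
by move=> + /or4P[] /eqP E; rewrite E /=; lia.
Qed.

(** [edges] is a choice among decompositions. Two of them differ by a vanishing combination of
    alternating sums over the union of their finite supports, and [sumS_free] makes its coefficients
    0. *)
Lemma edgesE {R : realType} mu : edges R mu = fun nu => (nu \in nbrs mu) : nat.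
Proof.
apply: xget_unique; first exact: decomposes_nbrs.
move=> c [cfin cE]; pose n nu : nat := nu \in nbrs mu.
have [nfin nE] : @decomposes R mu n by exact: decomposes_nbrs.
rewrite -/n.
pose A := [set nu | c nu != 0%N] `|` [set nu | n nu != 0%N].
have Afin : finite_set A by rewrite finite_setU; split.
pose s : seq Pplus := finmap.enum_fset (fset_set A).
have AE (m : Pplus -> nat) (w : R[i] * R[i]) : [set nu | m nu != 0%N] `<=` A ->
    \sum_(nu \in [set: Pplus]) (m nu)%:R * @chi R (val nu) w
    = \sum_(nu <- s) (m nu)%:R * @chi R (val nu) w.
  move=> mA; rewrite -(fsbig_widen A) ?fsbig_finite//.
  move=> nu /= [_ nA]; suff -> : m nu = 0%N by rewrite mul0r.
  by apply/eqP/negPn/negP => /mA.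
have cnA nu : nu \in s -> (c nu)%:R - (n nu)%:R = 0 :> R[i].
  apply: (sumS_free s (fun nu => (c nu)%:R - (n nu)%:R)) => [|w w1].
    exact: finmap.fset_uniq.
  (* [decomposes] says nothing at the zeros of [Salt rho1], but every term vanishes there. *)
  have [S0|S0] := eqVneq (Salt rho1 w) 0.
    by rewrite big1// => l _; rewrite Salt_singular// mulr0.
  have : \sum_(nu <- s) (c nu)%:R * @chi R (val nu) w
      = \sum_(nu <- s) (n nu)%:R * @chi R (val nu) w.
    by rewrite -!AE -?cE -?nE// => l; [right|left].
  move/(congr1 ( *%R^~ (Salt rho1 w))); rewrite !mulr_suml => E.
  under eq_bigr do rewrite mulrBl.
  rewrite sumrB; apply/eqP; rewrite subr_eq0; apply/eqP.
  under eq_bigr do rewrite -[Salt _ _](divfK S0) mulrA.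
  by rewrite E; apply: eq_bigr => l _; rewrite -mulrA divfK.
apply/funext => nu; have [nuA|] := pselect (A nu).
  have /cnA/eqP : nu \in s by rewrite in_fset_set// inE.
  by rewrite subr_eq0 eqr_nat => /eqP.
by move=> /not_orP[/negP/negPn/eqP-> /negP/negPn/eqP->].
Qed.

Lemma adjacencyE {R : realType} (f : Pplus -> R[i]) mu :
  adjacency f mu = \sum_(e <- dirs) oapp f 0 (insub (val mu + e)).
Proof. by rewrite /adjacency edgesE sum_nbrs. Qed.

Fixpoint walks (m i : nat) : nat :=
  if m isn't m'.+1 then (i == 0)%N else
  (walks m' i.+1 + if i isn't i'.+1 then 0 else walks m' i')%N.

(* In the coordinates [i = l.1 + l.2], [j = l.1 - l.2] the graph is a component
   of the product of two half-lines. *)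
Lemma adjacency_walks {R : realType} m (mu : Pplus) :
  iter m adjacency (delta star) mu
  = (walks m (absz ((val mu).1 + (val mu).2)%R)
     * walks m (absz ((val mu).1 - (val mu).2)%R))%:R :> R[i].
Proof.
elim: m mu => [|m IH] mu.
  rewrite /= /delta mulnb -val_eqE; congr (nat_of_bool _)%:R.
  by case: mu => [[x y] /= xy]; rewrite xpair_eqE; lia.
rewrite iterS adjacencyE.
(* Extending by 0 to negative integers absorbs the missing neighbours: a step out of [Pplus] brings
   one of the two half-line coordinates to -1. *)
pose wk (x : int) := if x is Posz i then walks m i else 0%N.
have wkE (e : int * int) : e \in dirs ->
    oapp (iter m adjacency (delta star)) 0 (insub (val mu + e)) =
    (wk ((val mu + e).1 + (val mu + e).2)%R
     * wk ((val mu + e).1 - (val mu + e).2)%R)%:R :> R[i].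
  move=> edirs; case: insubP => [nu _ <-|].
    rewrite /= IH; case: nu => [[x y] /= xy].
    have : 0 <= x + y by lia.
    have : 0 <= x - y by lia.
    by case: (x + y) (x - y) => [i|//] [j|//].
  case: mu => [[x y] /= xy] Nmue.
  have [|[k ->]|[k ->]] : [\/ False, exists k, x + e.1 + (y + e.2) = Negz k
    | exists k, x + e.1 - (y + e.2) = Negz k] => //=; rewrite ?mul0n ?muln0//.
  case: e edirs Nmue => a b; rewrite !inE !xpair_eqE /= => edirs Nmue.
  have [?|?] : x + a + (y + b) = -1 \/ x + a - (y + b) = -1 by lia.
    by apply: Or32; exists 0%N; lia.
  by apply: Or33; exists 0%N; lia.
rewrite (eq_big_seq _ wkE) !big_cons big_nil addr0 -!natrD; congr (_ %:R).
case: mu {wkE} => [[x y] /= xy].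
have wkS n : wk (n%:Z - 1) = if n is n'.+1 then walks m n' else 0%N.
  by case: n => // n; rewrite /wk (_ : n.+1%:Z - 1 = n)//; lia.
have [i xyi] : exists i : nat, x + y = i by exists (absz (x + y)); lia.
have [j xyj] : exists j : nat, x - y = j by exists (absz (x - y)); lia.
rewrite !addr0 xyi xyj /= -!wkS.
have -> : x + 1 + y = i.+1 by lia.
have -> : x - 1 + y = i%:Z - 1 by lia.
have -> : x + (y + 1) = i.+1 by lia.
have -> : x + (y - 1) = i%:Z - 1 by lia.
have -> : x + 1 - y = j.+1 by lia.
have -> : x - 1 - y = j%:Z - 1 by lia.
have -> : x - (y + 1) = j%:Z - 1 by lia.
have -> : x - (y - 1) = j.+1 by lia.
rewrite {1 3 5 7}/wk; ring.
Qed.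

Lemma walks_odd m i : odd (m + i) -> walks m i = 0%N.
Proof.
elim: m i => [|m IH] [|i] //= mi.
- by rewrite IH// addnS.
- by rewrite !IH//; move: mi; rewrite !addnS/= ?negbK.
Qed.

(** The partial sums are constant once the finite set contains [v0]. *)
Lemma sum_support1 {R : realType} (x : Pplus -> R[i]) v0 :
  (forall v, v != v0 -> x v = 0) ->
  summability.sum (x : Pplus -> R[i]^o) = x v0.
Proof.
move=> x0; have FF := @summability.totally_filter Pplus.
apply: cvg_lim; first exact: norm_hausdorff.

apply: cvg_near_cst; exists (finmap.fset1 v0) => //= B /= sB.
rewrite /summability.partial_sum.
rewrite -(finmap.big_seq_fsetE _ B xpredT x)/=.
rewrite (bigD1_seq v0) ?finmap.fset_uniq//=; last by rewrite -finmap.fsub1set.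
by rewrite big1 ?addr0// => v /x0.
Qed.

Lemma spectral_moment {R : realType} m :
  ell2_dot (iter m adjacency (delta star)) (delta star)
  = ((walks m 0 ^ 2)%N%:R : R)%:C%C.
Proof.
rewrite /ell2_dot (sum_support1 _ star).
  by rewrite adjacency_walks /delta eqxx conjc1 mulr1 rmorph_nat.
by move=> v vn; rewrite /delta (negbTE vn) conjc0 mulr0.
Qed.

(** * Moments determine a compactly supported measure *)

(** Each of the [n] terms of [s + ... + s^n] is at least [s^n], and that sum times [1 - s] is
    [s (1 - s^n)]. *)
Lemma natmul_expr_le {R : realFieldType} (s : R) n : 0 <= s <= 1 ->
  n%:R * s ^+ n * (1 - s) <= s * (1 - s ^+ n).
Proof.
move=> /andP[s0 s1]; elim: n => [|n IH]; first by rewrite !mul0r expr0 subrr mulr0.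
have := ler_wpM2l s0 IH; rewrite exprS -natr1.
have : 0 <= s ^+ n <= 1 by rewrite exprn_ge0 //= exprn_ile1.
move: (s ^+ n) => t /andP[t0 t1].
have : 0 <= s * (1 - s) * (1 - t) by rewrite !mulr_ge0 ?subr_ge0.
by lra.
Qed.

Lemma cvg_natmul_expr {R : realType} (r : R) : 0 <= r < 1 ->
  n%:R * r ^+ n @[n --> \oo] --> (0 : R).
Proof.
move=> /andP[r0 r1]; pose s := Num.sqrt r.
have s0 : 0 <= s by exact: sqrtr_ge0.
have s1 : s < 1 by rewrite -sqrtr1 ltr_sqrt.
apply: (@squeeze_cvgr _ _ _ _ (fun=> 0) (geometric (1 - s)^-1 s)).
- apply: nearW => n /=; rewrite mulr_ge0 ?exprn_ge0//= -(sqr_sqrtr r0) -/s.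
  rewrite exprAC expr2 mulrA ler_wpM2r ?exprn_ge0//.
  rewrite -[leRHS]mul1r ler_pdivlMr ?subr_gt0//.
  have s01 : 0 <= s <= 1 by rewrite s0 ltW.
  apply: (le_trans (natmul_expr_le _ n s01)).
  by rewrite mulr_ile1 ?subr_ge0 ?exprn_ile1 ?(ltW s1)// gerBl exprn_ge0.
- exact: cvg_cst.
- by apply: cvg_geometric; rewrite ger0_norm.
Qed.

Lemma bernoulli_ge {R : realFieldType} (y : R) n : 0 <= y <= 1 ->
  1 - n%:R * y <= (1 - y) ^+ n.
Proof.
move=> y01; elim: n => [|n IH]; first by rewrite mul0r subr0 expr0.
rewrite exprS -natr1; move: ((1 - y) ^+ n) IH => t IH.
have : 0 <= (1 - y) * (t - (1 - n%:R * y)) by rewrite mulr_ge0 ?subr_ge0//; lra.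
have : 0 <= n%:R * (y * y) by rewrite !mulr_ge0//; lra.
by lra.
Qed.

Lemma bernoulli_le {R : realFieldType} (y : R) n : 0 <= y <= 1 ->
  (1 - y) ^+ n * (1 + n%:R * y) <= 1.
Proof.
move=> y01; elim: n => [|n IH]; first by rewrite mul0r addr0 expr0 mulr1.
have y0 : 0 <= (1 - y) ^+ n by rewrite exprn_ge0//; lra.
have n0 : 0 <= n%:R :> R by [].
apply: le_trans IH; rewrite exprSr -mulrA ler_wpM2l// -natr1.
by nra.
Qed.

(* The exponent is [n * 2 ^ n] rather than [2 ^ n] so that the limit is 0, not
   [expR (-1)], at the threshold [q = 1 / 2]. *)
Lemma cvg_step {R : realType} (q : R) : 0 <= q <= 1 ->
  (1 - q ^+ n) ^+ (n * 2 ^ n)%N @[n --> \oo] --> ((q < 1 / 2)%R%:R : R).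
Proof.
move=> q01; have qn n : 0 <= q ^+ n <= 1.
  by case/andP: q01 => ? ?; rewrite exprn_ge0 //= exprn_ile1.
(* Bernoulli's bounds depend on this product only: it tends to 0 for [q < 1 / 2] and is at least [n]
   otherwise. *)
have Nq n : (n * 2 ^ n)%:R * q ^+ n = n%:R * (2 * q) ^+ n :> R.
  by rewrite natrM natrX exprMn mulrA.
have [q2|] := boolP (q < 1 / 2); last first.
  rewrite -leNgt => q2.
  apply: (@squeeze_cvgr _ _ _ _ (fun=> 0) (fun n => n.+1%:R^-1)); last 2 first.
  - exact: cvg_cst.
  - exact: cvg_harmonic.
  apply: nearW => n; rewrite exprn_ge0/=; last by have := qn n; lra.
  rewrite -[leRHS]mul1r ler_pdivlMr//.
  apply: (le_trans _ (bernoulli_le _ (n * 2 ^ n)%N (qn n))).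
  rewrite ler_wpM2l//; first by rewrite exprn_ge0//; have := qn n; lra.
  by rewrite -natr1 addrC lerD2l Nq ler_peMr// exprn_ege1//; lra.
apply: (@squeeze_cvgr _ _ _ _ (fun n => 1 - n%:R * (2 * q) ^+ n) (fun=> 1)).
- by apply: nearW => n; rewrite -Nq bernoulli_ge//= exprn_ile1//; have := qn n; lra.
- rewrite -[X in _ --> X]subr0; apply: cvgB; first exact: cvg_cst.
  by apply: cvg_natmul_expr; lra.
- exact: cvg_cst.
Qed.

Section moment_unique.
Context {R : realType}.
Let T := measurableTypeR R.
Implicit Types (mu nu rho : probability (measurableTypeR R) R) (p : {poly R}).

Lemma continuous_horner p : continuous (fun t : R => p.[t]).
Proof.
elim/poly_ind: p => [|p c IH] x.
  by under eq_fun do rewrite horner0; exact: cst_continuous.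
under eq_fun do rewrite hornerMXaddC.
by apply: cvgD; [apply: cvgM; [exact: IH|exact: cvg_id]|exact: cvg_cst].
Qed.

Lemma measurable_horner p (D : set T) : measurable_fun D (fun t : T => p.[t]).
Proof.
apply: measurable_funTS; apply: continuous_measurable_fun.
exact: continuous_horner.
Qed.

Lemma integrable_horner mu (M : R) p : mu (~` `[- M, M]) = 0%E ->
  mu.-integrable [set: T] (fun t => p.[t]%:E).
Proof.
move=> muM.
have mM : measurable (`[- M, M] : set T) by exact: measurable_itv.
have MU : [set: T] `\` ~` `[- M, M] = `[- M, M]%classic by rewrite setTD setCK.
have mp : measurable_fun setT (fun t : T => p.[t]%:E).
  by apply/measurable_EFinP; exact: measurable_horner.
apply/(negligible_integrable (measurableC mM) measurableT mp muM).
rewrite MU; apply: measurable_bounded_integrable => //.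
- by rewrite (le_lt_trans (probability_le1 _ _))// ltry.
- exact: measurable_horner.
have : compact ((fun t => p.[t]) @` `[- M, M]).
  apply: continuous_compact; last exact: segment_compact.
  exact/continuous_subspaceT/continuous_horner.
move/compact_bounded => [C [Creal HC]]; exists C; split => // x Cx y My.
by apply: (HC x Cx); exists y.
Qed.

Lemma eq_moment_horner mu nu (M : R) p :
  mu (~` `[- M, M]) = 0%E -> nu (~` `[- M, M]) = 0%E ->
  (forall m, \int[mu]_t t ^+ m = \int[nu]_t t ^+ m) ->
  \int[mu]_t p.[t] = \int[nu]_t p.[t].
Proof.
move=> muM nuM E.
have int rho n : rho (~` `[- M, M]) = 0%E ->
    rho.-integrable [set: T] (fun t => (t ^+ n)%:E).
  move=> rhoM; under eq_fun do rewrite -hornerXn.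
  exact: (integrable_horner _ M).
have poly rho : rho (~` `[- M, M]) = 0%E ->
    \int[rho]_t p.[t] = \sum_(i < size p) p`_i * \int[rho]_t t ^+ i.
  move=> rhoM; under eq_Rintegral do rewrite horner_coef.
  elim: (size p) => [|n IH].
    rewrite big_ord0; under eq_Rintegral do rewrite big_ord0.
    by rewrite Rintegral_cst// mul0r.
  under eq_Rintegral do rewrite big_ord_recr/=.
  rewrite RintegralD//.
  - by rewrite big_ord_recr/= -IH RintegralZl//; exact: int.
  - rewrite (_ : _ \o _ = fun t => (\sum_(i < n) p`_i *: 'X^i).[t]%:E).
      exact: (integrable_horner _ M).
    apply/funext => t /=; rewrite horner_sum; congr EFin; apply: eq_bigr => i _.
    by rewrite hornerZ hornerXn.
  - rewrite (_ : _ \o _ = fun t => (p`_n)%:E * (t ^+ n)%:E)%E.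
      exact/integrableZl/int.
    by apply/funext => t /=; rewrite EFinM.
by rewrite !poly//; apply: eq_bigr => i _; rewrite E.
Qed.

(** The inner affine map sends [[-M, M]] into [[0, 1]] and [a] to [1 / 2], so by [cvg_step] these
    polynomials tend on [[-M, M]] to the indicator of [t < a]. *)
Let ray_poly (M a : R) n : {poly R} :=
  (1 - ((1 / 2)%:P + (2 * (`|M| + `|a| + 1))^-1 *: ('X - a%:P)) ^+ n)
    ^+ (n * 2 ^ n).

(** Dominated convergence with bound 1; the limit and the bound hold on [[-M, M]], hence almost
    everywhere. *)
Lemma cvg_ray_poly mu (M a : R) : mu (~` `[- M, M]) = 0%E ->
  (\int[mu]_t (ray_poly M a n).[t]%:E)%E @[n --> \oo] --> mu `]-oo, a[%classic.
Proof.
move=> muM.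
pose q t := 1 / 2 + (2 * (`|M| + `|a| + 1))^-1 * (t - a).
have polyE n t : (ray_poly M a n).[t] = (1 - q t ^+ n) ^+ (n * 2 ^ n).
  by rewrite /ray_poly horner_exp !hornerE /q mul1r.
pose L := `|M| + `|a| + 1.
have L0 : 0 < L by have := normr_ge0 M; have := normr_ge0 a; rewrite /L; lra.
have q01 t : t \in `[- M, M] -> 0 <= q t <= 1.
  rewrite in_itv /= => tM.
  have tL : - 1 <= (t - a) / L <= 1.
    rewrite ler_pdivlMr// ler_pdivrMr//.
    have := ler_norm M; have := ler_norm a; have := ler_norm (- a).
    by rewrite normrN /L; lra.
  have -> : q t = 1 / 2 + (t - a) / L / 2 by rewrite /q -/L; field; rewrite gt_eqF.
  by lra.
have q12 t : (q t < 1 / 2) = (t < a).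
  rewrite /q -/L gtrDl pmulr_rlt0 ?subr_lt0// invr_gt0; lra.
have aeM (Q : T -> Prop) :
    (forall t, t \in `[- M, M] -> Q t) -> {ae mu, forall t, Q t}.
  move=> H; exists (~` `[- M, M]); split => //.
    by apply: measurableC; exact: measurable_itv.
  by move=> t /= Qt tM; apply: Qt; exact: H.
have := @dominated_convergence _ _ _ mu setT measurableT
  (fun n t => (ray_poly M a n).[t]%:E)
  (fun t => (\1_(`]-oo, a[ : set T) t)%:E) (fun=> 1%:E).
case.
- by move=> n; apply/measurable_EFinP; exact: measurable_horner.
- by apply/measurable_EFinP; apply: measurable_indic; exact: measurable_itv.
- apply: aeM => t tM _; apply: cvg_EFin; first exact: nearW.
  rewrite /comp /=; under eq_fun do rewrite polyE.
  rewrite (_ : \1_ _ _ = (q t < 1 / 2)%R%:R); first exact/cvg_step/q01.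
  by rewrite q12 indicE mem_setE in_itv.
- by apply: finite_measure_integrable_cst.
- apply: aeM => t /q01 tM n _ /=; rewrite lee_fin polyE.
  have : 0 <= q t ^+ n <= 1.
    by case/andP: tM => ? ?; rewrite exprn_ge0 //= exprn_ile1.
  move=> qn; rewrite ger0_norm; last by rewrite exprn_ge0//; lra.
  by rewrite exprn_ile1//; lra.
move=> _ _; rewrite integral_indic ?setIT//.
Qed.

(** Equal moments give equal integrals of [ray_poly], so the measures agree on open left rays, a
    family closed under intersection that generates the Borel sets. *)
Lemma moments_unique mu nu (M : R) :
  mu (~` `[- M, M]) = 0%E -> nu (~` `[- M, M]) = 0%E ->
  (forall m, \int[mu]_t t ^+ m = \int[nu]_t t ^+ m) ->
  forall A, measurable A -> mu A = nu A.
Proof.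
move=> muM nuM E.
move=> A mA; apply: (@measure_unique _ _ T (@RGenInftyO.G R)
  (fun n => `]-oo, n%:R[%classic) (RGenInftyO.measurableE R) _ _ _ mu nu) => //.
- move=> _ _ [x ->] [y ->]; exists (Num.min x y).
  by apply/seteqP; split => z /=; rewrite !in_itv/= lt_min => /andP.
- by move=> n; exists n%:R.
- apply/seteqP; split => // x _; exists (Num.truncn `|x|).+1 => //=.
  by rewrite in_itv /= (le_lt_trans (ler_norm x))// truncnS_gt.
- move=> _ [a ->].
  have munu : (fun n => \int[mu]_t (ray_poly M a n).[t]%:E)%E
      = (fun n => \int[nu]_t (ray_poly M a n).[t]%:E)%E.
    apply/funext => n; rewrite -[LHS]fineK ?integrable_fin_num//; last first.
      exact: (integrable_horner _ M).
    rewrite -[RHS]fineK ?integrable_fin_num//; last exact: (integrable_horner _ M).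
    by congr EFin; exact: (eq_moment_horner _ _ M).
  have := cvg_ray_poly mu M a muM; rewrite munu => nuE.
  exact: (cvg_unique _ nuE (cvg_ray_poly nu M a nuM)).
- by move=> n; rewrite (le_lt_trans (probability_le1 _ _))// ltry.
Qed.

End moment_unique.

(** * Semicircle moments *)

Section calculus.
Context {R : realType}.
Implicit Types (F f : R -> R) (a b : R).

Lemma is_derive_LRcontinuous F f a b :
  (forall x : R, is_derive x (1 : R) F (f x)) -> derivable_oo_LRcontinuous F a b.
Proof.
move=> Ff; have cF : continuous F.
  move=> x; apply/differentiable_continuous/derivable1_diffP.
  exact: ex_derive.
split=> [x _||]; first exact: ex_derive.
  exact/cvg_at_right_filter/cF.
exact/cvg_at_left_filter/cF.
Qed.

Lemma Rintegral_FTC F f a b : a < b -> (forall x : R, is_derive x (1 : R) F (f x)) ->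
  continuous f -> \int[lebesgue_measure]_(x in `[a, b]) f x = F b - F a.
Proof.
move=> ab Ff cf; rewrite /Rintegral (@continuous_FTC2 _ f F)//.
- exact: continuous_subspaceT.
- exact: is_derive_LRcontinuous Ff.
- by move=> x _; rewrite derive1E derive_val.
Qed.

Lemma sin_natpi n : sin (n%:R * pi) = 0 :> R.
Proof.
elim: n => [|n IH]; first by rewrite mul0r sin0.
by rewrite -natr1 mulrDl mul1r sinDpi IH oppr0.
Qed.

Lemma continuous_sinM (k : R) : continuous (fun t => sin (k * t)).
Proof.
move=> x; apply: continuous_comp; last exact: continuous_sin.
by apply: cvgM; [exact: cvg_cst|exact: cvg_id].
Qed.

(** Both sides obey one recursion, since [2 cos t sin ((i + 1) t) = sin ((i + 2) t) + sin (i t)].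
    The case [m = 0] is the orthogonality of the sines on [[0, pi]]. *)
Lemma Rintegral_walks m i :
  \int[lebesgue_measure]_(t in `[0, pi])
    ((2 * cos t) ^+ m * sin (i.+1%:R * t) * sin t)
  = (walks m i)%:R * (pi / 2) :> R.
Proof.
have cX n : continuous (fun t : R => (2 * cos t) ^+ n).
  move=> x; apply: (@continuous_comp _ _ _ (fun t => 2 * cos t) (fun y => y ^+ n)).
    by apply: cvgM; [exact: cvg_cst|exact: continuous_cos].
  exact: exprn_continuous.
have cint n (k : R) : continuous (fun t => (2 * cos t) ^+ n * sin (k * t) * sin t).
  move=> x; apply: cvgM; last exact: continuous_sin.
  by apply: cvgM; [exact: cX|exact: continuous_sinM].
have int n (k : R) : lebesgue_measure.-integrable `[0, pi]
   (EFin \o (fun t => (2 * cos t) ^+ n * sin (k * t) * sin t)).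
  apply: continuous_compact_integrable; first exact: segment_compact.
  exact: continuous_subspaceT.
elim: m i => [|m IH] i.
  case: i => [|i].
    have dF (x : R) : is_derive x (1 : R) (fun t => t / 2 - sin t * cos t / 2 : R)
        ((2 * cos x) ^+ 0 * sin (1 * x) * sin x).
      rewrite expr0 !mul1r; apply: is_derive_eq; rewrite /GRing.scale /=.
      by have := cos2Dsin2 x; lra.
    rewrite (Rintegral_FTC _ _ _ _ (pi_gt0 R) dF); last exact: cint.
    by rewrite sinpi sin0 !mul0r !subr0 mul1r.
  have dF (x : R) : is_derive x (1 : R)
      (fun t => sin (i.+1%:R * t) / (2 * i.+1%:R)
         - sin (i.+3%:R * t) / (2 * i.+3%:R) : R)
      ((2 * cos x) ^+ 0 * sin (i.+2%:R * x) * sin x).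
    have -> : (2 * cos x) ^+ 0 * sin (i.+2%:R * x) * sin x
        = (cos (i.+1%:R * x) - cos (i.+3%:R * x)) / 2.
      have -> : i.+3%:R * x = i.+2%:R * x + x by rewrite -(natr1 i.+2); ring.
      have -> : i.+1%:R * x = i.+2%:R * x - x by rewrite -(natr1 i.+1); ring.
      by rewrite cosB cosD expr0; field.
    apply: is_derive_eq; rewrite /GRing.scale /=.
    have p0 : i.+1%:R != 0 :> R by rewrite pnatr_eq0.
    have q0 : i.+3%:R != 0 :> R by rewrite pnatr_eq0.
    move: (i.+1%:R) (i.+3%:R) p0 q0 => p q p0 q0.
    by field; rewrite p0 q0.
  rewrite (Rintegral_FTC _ _ _ _ (pi_gt0 R) dF); last exact: cint.
  by rewrite !sin_natpi !mulr0 !sin0 !mul0r !subrr.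
rewrite natrD mulrDl -IH.
(* The missing neighbour of 0 corresponds to [sin (0 t) = 0]. *)
have -> : (if i is i'.+1 then walks m i' else 0%N)%:R * (pi / 2) =
    \int[lebesgue_measure]_(t in `[0, pi])
      ((2 * cos t) ^+ m * sin (i%:R * t) * sin t) :> R.
  case: i => [|i]; last by rewrite IH.
  under eq_Rintegral do rewrite mul0r sin0 mulr0 mul0r.
  by rewrite Rintegral_cst// !mul0r.
rewrite -RintegralD//; apply: eq_Rintegral => t _.
have -> : i.+2%:R * t = i.+1%:R * t + t by rewrite -(natr1 i.+1); ring.
have -> : i%:R * t = i.+1%:R * t - t by rewrite -(natr1 i); ring.
by rewrite sinB sinD exprSr; ring.
Qed.

End calculus.

(** * Integrals of even functions *)

Section reflection.
Context {R : realType}.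
Local Notation mu := (@lebesgue_measure R).
Local Open Scope ereal_scope.

Lemma ge0_integral_reflect (a b : R) (f : R -> \bar R) :
  measurable_fun [set: R] f -> (forall x, 0 <= f x) ->
  \int[mu]_(x in `[a, b]) f x = \int[mu]_(x in `[(- b)%R, (- a)%R]) f (- x)%R.
Proof.
move=> mf f0.
have -> : `[(- b)%R, (- a)%R]%classic = (-%R : _ -> measurableTypeR R) @^-1` `[a, b].
  by rewrite opp_preimage_itvbndbnd.
transitivity (\int[pushforward mu (-%R : _ -> measurableTypeR R)]_(x in `[a, b]) f x).
  by apply: eq_measure_integral => //= A mA AS; exact/esym/lebesgue_measureN.
by rewrite ge0_integral_pushforward//; exact: measurable_funTS.
Qed.

Lemma ge0_integral_even (a : R) (f : R -> \bar R) : (0 <= a)%R ->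
  measurable_fun [set: R] f -> (forall x, 0 <= f x) ->
  (forall x, f (- x)%R = f x) ->
  \int[mu]_(x in `[(- a)%R, a]) f x = 2%:E * \int[mu]_(x in `[0%R, a]) f x.
Proof.
move=> a0 mf f0 fN.
rewrite (_ : `[(- a)%R, a]%classic = `[(- a)%R, 0%R[ `|` `[0%R, a]); last first.
  by rewrite -itv_bndbnd_setU ?bnd_simp ?oppr_le0.
rewrite ge0_integral_setU//=; last 2 first.
  exact: measurable_funTS.
  apply/disj_setPS => x [] /=; rewrite !in_itv/= => /andP[_ x0] /andP[].
  by rewrite leNgt x0.
rewrite integral_itv_bndo_bndc; last exact: measurable_funTS.
rewrite ge0_integral_reflect// opprK oppr0.
by under eq_integral do rewrite fN; rewrite mule_natl mule2n.
Qed.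

End reflection.

(** * Monotone change of variables *)

Section substitution.
Context {R : realType}.
Implicit Types F f G : R -> R.

Lemma derive1_fun F f : (forall x : R, is_derive x (1 : R) F (f x)) ->
  F^`()%classic = f.
Proof. by move=> Ff; apply/funext => x; rewrite derive1E derive_val. Qed.

Lemma integral_subst_increasing F f G (a b : R) : a <= b ->
  {in `[a, b] &, {homo F : x y / x < y}} ->
  (forall x : R, is_derive x (1 : R) F (f x)) -> continuous f ->
  {within `[F a, F b], continuous G} ->
  (\int[lebesgue_measure]_(x in `[F a, F b]) (G x)%:E
   = \int[lebesgue_measure]_(x in `[a, b]) (G (F x) * f x)%:E)%E.
Proof.
move=> ab Fincr Ff cf cG; have Ff' := derive1_fun _ _ Ff.
rewrite integration_by_substitution_increasing//; rewrite ?Ff'//.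
- by apply/cvg_ex; exists (f a); exact/cvg_at_right_filter/cf.
- by apply/cvg_ex; exists (f b); exact/cvg_at_left_filter/cf.
- exact: is_derive_LRcontinuous Ff.
Qed.

Lemma integral_subst_decreasing F f G (a b : R) : a <= b ->
  {in `[a, b] &, {homo F : x y /~ x < y}} ->
  (forall x : R, is_derive x (1 : R) F (f x)) -> continuous f ->
  {within `[F b, F a], continuous G} ->
  (\int[lebesgue_measure]_(x in `[F b, F a]) (G x)%:E
   = \int[lebesgue_measure]_(x in `[a, b]) (G (F x) * - f x)%:E)%E.
Proof.
move=> ab Fincr Ff cf cG; have Ff' := derive1_fun _ _ Ff.
rewrite integration_by_substitution_decreasing//; rewrite ?Ff'//.
- by apply/cvg_ex; exists (f a); exact/cvg_at_right_filter/cf.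
- by apply/cvg_ex; exists (f b); exact/cvg_at_left_filter/cf.
- exact: is_derive_LRcontinuous Ff.
Qed.

End substitution.

Lemma cvg_sqrt_comp {R : realType} (f : R -> R) (x l : R) :
  f t @[t --> x] --> l -> Num.sqrt (f t) @[t --> x] --> Num.sqrt l.
Proof. by move=> fl; apply: continuous_cvg => //; exact: sqrt_continuous. Qed.

Lemma continuous_semicircle {R : realType} n :
  continuous (fun t : R => t ^+ n * Num.sqrt (4 - t ^+ 2)).
Proof.
move=> t; apply: cvgM; first exact: exprn_continuous.
by apply: cvg_sqrt_comp; apply: cvgB; [exact: cvg_cst|exact: exprn_continuous].
Qed.

(** By evenness twice the integral is the one over [[-2, 2]], where [t = 2 cos u] gives
    [sqrt (4 - t^2) = 2 sin u] and four times the integral of [Rintegral_walks] at [i = 0]. *)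
Lemma semicircle_moment {R : realType} n :
  (\int[lebesgue_measure]_(t in `[0%R, 2%R])
     (t ^+ (2 * n) * Num.sqrt (4 - t ^+ 2))%:E)%E
  = ((walks (2 * n) 0)%:R * pi : R)%:E.
Proof.
pose G (t : R) := t ^+ (2 * n) * Num.sqrt (4 - t ^+ 2).
have cG : continuous G by exact: continuous_semicircle.
have G0 t : 0 <= G t by rewrite mulr_ge0 ?sqrtr_ge0// exprM exprn_ge0 ?sqr_ge0.
have GN t : G (- t) = G t by rewrite /G exprM sqrrN -exprM.
have cint : continuous (fun t : R => (2 * cos t) ^+ (2 * n) * sin (1 * t) * sin t).
  move=> x; apply: cvgM; last exact: continuous_sin.
  apply: cvgM; last exact: continuous_sinM.
  apply: (@continuous_comp _ _ _ (fun t => 2 * cos t) (fun y => y ^+ (2 * n))).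
    by apply: cvgM; [exact: cvg_cst|exact: continuous_cos].
  exact: exprn_continuous.
have int : lebesgue_measure.-integrable `[0, pi]
   (EFin \o (fun t : R => (2 * cos t) ^+ (2 * n) * sin (1 * t) * sin t)).
  apply: continuous_compact_integrable; first exact: segment_compact.
  exact: continuous_subspaceT.
have walksE := @Rintegral_walks R (2 * n) 0.
have : (2%:E * \int[lebesgue_measure]_(t in `[0%R, 2%R]) (G t)%:E)%E
    = (2 * ((walks (2 * n) 0)%:R * pi))%:E.
  have mG : measurable_fun [set: R] (fun t => (G t)%:E).
    by apply/measurable_EFinP; exact: continuous_measurable_fun.
  rewrite -(ge0_integral_even 2 _ _ mG)//; last by move=> t; rewrite GN.
  have dF (x : R) : is_derive x (1 : R) (fun t => 2 * cos t) (- (2 * sin x)).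
    by apply: is_derive_eq; rewrite /GRing.scale /=; ring.
  have E0 : 2 * cos 0 = 2 :> R by rewrite cos0 mulr1.
  have Epi : 2 * cos pi = - 2 :> R by rewrite cospi mulrN1.
  have homoF : {in `[0, pi] &, {homo (fun t : R => 2 * cos t) : x y /~ x < y}}.
    by move=> x y xpi ypi /=; rewrite ltr_pM2l// ltr_cos.
  have cF : continuous (fun x : R => - (2 * sin x)).
    by move=> x; apply: cvgN; apply: cvgM; [exact: cvg_cst|exact: continuous_sin].
  have := integral_subst_decreasing _ _ G _ _ (pi_ge0 R) homoF dF cF.
  rewrite /= E0 Epi => ->; last exact: continuous_subspaceT.
  transitivity (\int[@lebesgue_measure R]_(t in `[0%R, pi])
      (4%:E * ((2 * cos t) ^+ (2 * n) * sin (1 * t) * sin t)%:E))%E; last first.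
    rewrite integralZl// -[X in (_ * X)%E]fineK ?integrable_fin_num//.
    by rewrite -/(Rintegral _ _ _) walksE -EFinM; congr EFin; field.
  apply: eq_integral => t; rewrite inE /= in_itv /= => tpi; rewrite -EFinM; congr EFin.
  have s0 : 0 <= sin t by exact: sin_ge0_pi.
  rewrite /G (_ : 4 - _ = (2 * sin t) ^+ 2); last first.
    by rewrite !exprMn; have := cos2Dsin2 t; lra.
  by rewrite sqrtr_sqr ger0_norm ?mulr_ge0// mul1r; ring.
set I := (\int[_]_(_ in _) _)%E => E2.
have : I = (2^-1 * (2 * ((walks (2 * n) 0)%:R * pi)) : R)%:E.
  by rewrite EFinM -E2 muleA -EFinM mulVf// mul1e.
by rewrite mulKf.
Qed.

(** * The density *)

Lemma integral_support {d} {T : measurableType d} {R : realType}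
    (mu : {measure set T -> \bar R}) (A B : set T) (f : T -> \bar R) :
  B `<=` A -> (forall x, A x -> ~ B x -> f x = 0%E) ->
  (\int[mu]_(x in A) f x = \int[mu]_(x in B) f x)%E.
Proof.
move=> BA f0; rewrite integral_mkcond [RHS]integral_mkcond.
apply: eq_integral => x _; rewrite !patchE.
have [xB|xB] := boolP (x \in B).
  by rewrite (_ : x \in A)//; move: xB; rewrite !inE; exact: BA.
have [xA|//] := boolP (x \in A); apply: f0; first by move: xA; rewrite inE.
by move=> /mem_set; apply/negP.
Qed.

Lemma cvg_exprn_comp {R : realType} (f : R -> R) (x l : R) n :
  f t @[t --> x] --> l -> f t ^+ n @[t --> x] --> l ^+ n.
Proof.
move=> fl; elim: n => [|n IH]; first by rewrite expr0; exact: cvg_cst.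
by rewrite exprS; under eq_fun do rewrite exprS; exact: cvgM.
Qed.

Section density.
Context {R : realType}.
Implicit Types x s t : R.
Local Notation mu := (@lebesgue_measure R).

Definition density x : R :=
  1 / (2 * pi ^+ 2 * `|x|) *
            ((x ^+ 2 + 16) * ellipticK ((x ^+ 2 - 16) / x ^+ 2)
             - 2 * x ^+ 2 * ellipticE ((x ^+ 2 - 16) / x ^+ 2)).

(* [Num.sqrt] is 0 on negative arguments, so [kern] vanishes outside
   [|x| / 2 <= |s| <= 2]; division by 0 makes it vanish at [s = 0]. *)
Definition kern x s : R :=
  Num.sqrt (4 - s ^+ 2) * Num.sqrt (4 * s ^+ 2 - x ^+ 2) / s ^+ 2.

Section fixed_x.
Context (x : R) (x04 : 0 < x < 4).

Let Q t : R := x ^+ 2 * cos t ^+ 2 + 16 * sin t ^+ 2.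
Let D t : R := Num.sqrt (Q t).

Let x16_gt0 : 0 < 16 - x ^+ 2.
Proof.
rewrite (_ : _ - _ = (4 - x) * (4 + x)); last by ring.
by move: x04 => /andP[? ?]; rewrite mulr_gt0//; lra.
Qed.

Let Q_gt0 t : 0 < Q t.
Proof.
rewrite (_ : Q t = x ^+ 2 + (16 - x ^+ 2) * sin t ^+ 2); last first.
  by rewrite /Q cos2sin2; ring.
have x2 : 0 < x ^+ 2 by rewrite exprn_gt0//; case/andP: x04.
have : 0 <= (16 - x ^+ 2) * sin t ^+ 2 by rewrite mulr_ge0 ?sqr_ge0// ltW.
by lra.
Qed.

Let D_gt0 t : 0 < D t. Proof. by rewrite sqrtr_gt0. Qed.

Let D2 t : D t ^+ 2 = Q t. Proof. by rewrite sqr_sqrtr// ltW. Qed.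

Let dQ t : is_derive t (1 : R) Q (2 * (16 - x ^+ 2) * sin t * cos t).
Proof. by apply: is_derive_eq; rewrite /GRing.scale /=; ring. Qed.

Let dD t : is_derive t (1 : R) D ((16 - x ^+ 2) * sin t * cos t / D t).
Proof.
have dsq := is_derive1_sqrt (Q_gt0 t).
apply: (is_derive_eq (@is_derive1_comp _ Num.sqrt Q t _ _ dsq (dQ t))).
by rewrite -/(D t); field; rewrite gt_eqF.
Qed.

Let cD : continuous D.
Proof.
move=> t; apply: cvg_sqrt_comp; apply: cvgD; apply: cvgM; try exact: cvg_cst.
  by apply: cvgM; exact: continuous_cos.
by apply: cvgM; exact: continuous_sin.
Qed.

Let cDV : continuous (fun t => (D t)^-1).
Proof. by move=> t; apply: cvgV; [rewrite gt_eqF|exact: cD]. Qed.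

(** For this parameter [m], the product [x^2 (1 - m sin^2 t)] is [x^2 + (16 - x^2) sin^2 t], that is
    [Q t]. *)
Let elliptic_integrand t :
  Num.sqrt (1 - (x ^+ 2 - 16) / x ^+ 2 * sin t ^+ 2) = D t / x.
Proof.
have x0 : 0 < x by case/andP: x04.
rewrite -[X in _ = _ / X](gtr0_norm x0) -sqrtr_sqr -sqrtrV ?sqr_ge0// -sqrtrM ?ltW//.
congr (Num.sqrt _); rewrite /Q cos2sin2; field; by rewrite gt_eqF.
Qed.

Let int (f : R -> R) : continuous f -> mu.-integrable `[0, pi / 2] (EFin \o f).
Proof.
move=> cf; apply: continuous_compact_integrable; first exact: segment_compact.
exact: continuous_subspaceT.
Qed.

Let J t := (16 - x ^+ 2) ^+ 2 * (sin t * cos t) ^+ 2 / D t ^+ 3.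

Let cJ : continuous J.
Proof.
move=> t; apply: cvgM; last first.
  by apply: cvgV; [rewrite expf_neq0// gt_eqF|apply: cvg_exprn_comp; exact: cD].
apply: cvgM; first exact: cvg_cst.
apply: cvg_exprn_comp.
by apply: cvgM; [exact: continuous_sin|exact: continuous_cos].
Qed.

Lemma density_J : density x = 1 / (2 * pi ^+ 2) * \int[mu]_(t in `[0, pi / 2]) J t.
Proof.
have x0 : 0 < x by case/andP: x04.
have KE : ellipticK ((x ^+ 2 - 16) / x ^+ 2)
    = x * \int[mu]_(t in `[0, pi / 2]) (D t)^-1.
  rewrite -RintegralZl//; last exact: int.
  by apply: eq_Rintegral => t _; rewrite elliptic_integrand invf_div.
have EE : ellipticE ((x ^+ 2 - 16) / x ^+ 2)
    = x^-1 * \int[mu]_(t in `[0, pi / 2]) D t.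
  rewrite -RintegralZl//; last exact: int.
  by apply: eq_Rintegral => t _; rewrite elliptic_integrand mulrC.
(* [f] is the derivative of [(16 - x^2) sin t cos t / D t], which vanishes at 0 and [pi / 2]; its
   zero integral expresses that of [J] through those of [1 / D] and [D], i.e. through K and E. *)
pose f t := (x ^+ 2 + 16) * (D t)^-1 - 2 * D t - J t.
have dF t : is_derive t (1 : R)
    (fun t => (16 - x ^+ 2) * (sin t * cos t) * (D t)^-1) (f t).
  have D0 : D t != 0 by rewrite gt_eqF.
  have dV := is_deriveV D0 (dD t).
  apply: is_derive_eq; rewrite /GRing.scale /= /f /J.
  have QE : 2 * Q t = x ^+ 2 + 16 - (16 - x ^+ 2) * (cos t ^+ 2 - sin t ^+ 2).
    by rewrite /Q cos2sin2; ring.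
  have -> : 2 * D t = (x ^+ 2 + 16 - (16 - x ^+ 2) * (cos t ^+ 2 - sin t ^+ 2)) / D t.
    by rewrite -QE -D2; field; rewrite D0.
  by field; rewrite D0.
have c1 : continuous (fun t => (x ^+ 2 + 16) * (D t)^-1).
  by move=> t; apply: cvgM; [exact: cvg_cst|exact: cDV].
have c2 : continuous (fun t => 2 * D t).
  by move=> t; apply: cvgM; [exact: cvg_cst|exact: cD].
have c12 : continuous (fun t => (x ^+ 2 + 16) * (D t)^-1 - 2 * D t).
  by move=> t; apply: cvgB; [exact: c1|exact: c2].
have cf : continuous f by move=> t; apply: cvgB; [exact: c12|exact: cJ].
have pi2 : 0 < pi / 2 :> R by rewrite divr_gt0 ?pi_gt0.
have := Rintegral_FTC _ _ _ _ pi2 dF cf.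
rewrite /f RintegralB//; [|exact: int..].
rewrite RintegralB//; [|exact: int..].
rewrite RintegralZl//; last exact: int.
rewrite RintegralZl//; last exact: int.
rewrite cos_pihalf sin0 !(mulr0, mul0r) subr0 => /eqP; rewrite subr_eq0 => /eqP <-.
rewrite /density KE EE gtr0_norm//.
move: (\int[mu]_(t in _) (D t)^-1) (\int[mu]_(t in _) D t) => I1 I2.
have : pi != 0 :> R by rewrite gt_eqF// pi_gt0.
move: (@pi R) => p p0; field.
by rewrite p0 gt_eqF.
Qed.

Lemma J_kern : (\int[mu]_(t in `[0%R, (pi / 2)%R]) (J t)%:E
  = \int[mu]_(s in `[0%R, 2%R]) (kern x s)%:E)%E.
Proof.
have [x0 x4] : 0 < x /\ x < 4 by apply/andP.
(* With [s = D t / 2] both radicands of [kern] become squares: [4 - s^2 = (16 - x^2) cos^2 t / 4]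
   and [4 s^2 - x^2 = (16 - x^2) sin^2 t]. *)
pose F t := D t / 2.
have dF t : is_derive t (1 : R) F ((16 - x ^+ 2) * sin t * cos t / D t / 2).
  have dDt := dD t; rewrite /F; apply: is_derive_eq; rewrite /GRing.scale /=; ring.
have F0 : F 0 = x / 2.
  by rewrite /F /D /Q cos0 sin0 expr1n expr0n mulr0 addr0 mulr1 sqrtr_sqr gtr0_norm.
have F1 : F (pi / 2) = 2.
  rewrite /F /D /Q cos_pihalf sin_pihalf expr1n expr0n mulr0 add0r mulr1.
  by rewrite (_ : 16 = 4 ^+ 2) ?sqrtr_sqr ?ger0_norm//; [field|ring].
have cdF : continuous (fun t => (16 - x ^+ 2) * sin t * cos t / D t / 2).
  move=> t; apply: cvgM; last exact: cvg_cst.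
  apply: cvgM; last exact: cDV.
  apply: cvgM; last exact: continuous_cos.
  by apply: cvgM; [exact: cvg_cst|exact: continuous_sin].
have pi2 : 0 <= pi / 2 :> R by rewrite divr_ge0 ?pi_ge0.
have Fincr : {in `[0, pi / 2] &, {homo F : t u / t < u}}.
  move=> t u; rewrite !in_itv /= => t0 u0 tu; rewrite /F ltr_pM2r// ltr_sqrt//.
  rewrite /Q !cos2sin2 -subr_gt0.
  have st : 0 <= sin t by apply: sin_ge0_pi; have := pi_ge0 R; lra.
  have su : sin t < sin u by rewrite ltr_sin// in_itv/=; have := pi_ge0 R; lra.
  rewrite (_ : _ - _ = (16 - x ^+ 2) * ((sin u - sin t) * (sin u + sin t))); last first.
    by ring.
  by rewrite !mulr_gt0//; lra.
have ck : {within `[F 0, F (pi / 2)], continuous (kern x)}.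
  apply/continuous_in_subspaceT => s; rewrite inE /= in_itv /= F0 => /andP[s0 _].
  have sn0 : s ^+ 2 != 0 by rewrite expf_neq0// gt_eqF//; lra.
  apply: cvgM; last by apply: cvgV => //; exact: exprn_continuous.
  apply: cvgM; apply: cvg_sqrt_comp.
    by apply: cvgB; [exact: cvg_cst|exact: exprn_continuous].
  apply: cvgB; last exact: cvg_cst.
  by apply: cvgM; [exact: cvg_cst|exact: exprn_continuous].
(* [F] covers only [[x / 2, 2]]; below [x / 2] the second square root is 0. *)
have -> : (\int[mu]_(s in `[0%R, 2%R]) (kern x s)%:E
    = \int[mu]_(s in `[F 0%R, F (pi / 2)%R]) (kern x s)%:E)%E.
  apply: integral_support.
    by move=> s /=; rewrite !in_itv/= F0 F1; lra.
  move=> s /=; rewrite !in_itv/= F0 F1 => s02 /negP sx; congr EFin.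
  rewrite /kern (@ler0_sqrtr _ (4 * s ^+ 2 - x ^+ 2)) ?mulr0 ?mul0r//.
  have {}sx : 0 <= s < x / 2 by lra.
  by nra.
rewrite (integral_subst_increasing _ _ _ _ _ pi2 Fincr dF cdF ck).
apply: eq_integral => t; rewrite inE/= in_itv/= => tpi; congr EFin.
have c0 : 0 <= cos t by apply: cos_ge0_pihalf; lra.
have s0 : 0 <= sin t by apply: sin_ge0_pi; have := pi_ge0 R; lra.
pose y := Num.sqrt (16 - x ^+ 2).
have y2 : y ^+ 2 = 16 - x ^+ 2 by rewrite sqr_sqrtr// ltW.
have y0 : 0 <= y by exact: sqrtr_ge0.
rewrite /kern /F (_ : 4 - _ = (y * cos t / 2) ^+ 2); last first.
  by rewrite !exprMn y2 D2 /Q cos2sin2; field.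
rewrite (_ : 4 * _ - _ = (y * sin t) ^+ 2); last first.
  by rewrite !exprMn y2 D2 /Q cos2sin2; field.
rewrite !sqrtr_sqr !ger0_norm ?mulr_ge0// /J -y2; field.
by rewrite gt_eqF.
Qed.

Lemma density_kern : (density x)%:E
  = ((1 / (2 * pi ^+ 2))%:E * \int[mu]_(s in `[0%R, 2%R]) (kern x s)%:E)%E.
Proof.
rewrite density_J -J_kern /Rintegral EFinM fineK//.
by apply: integrable_fin_num => //; exact: int.
Qed.

End fixed_x.
End density.

Lemma measurable_inv {R : realType} : measurable_fun [set: R] (fun x : R => x^-1).
Proof.
rewrite -(setUv [set (0 : R)]); apply/measurable_funU => //; first exact: measurableC.
split; first exact: measurable_fun_set1.
apply: open_continuous_measurable_fun; first apply: closed_openC.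
  exact/accessible_closed_set1/hausdorff_accessible/Rhausdorff.
by move=> x; rewrite inE => /eqP x0; apply: inv_continuous.
Qed.

(** * Even moments of the kernel by exchanging integrals *)

Section tonelli.
Context {R : realType}.
Local Notation mu := (@lebesgue_measure R).
Implicit Types x s t : R.

Lemma kern_ge0 x s : 0 <= kern x s.
Proof.
by apply: divr_ge0; [apply: mulr_ge0; exact: sqrtr_ge0|exact: sqr_ge0].
Qed.

Lemma kernN x s : kern (- x) s = kern x s.
Proof. by rewrite /kern sqrrN. Qed.

Lemma measurable_kern :
  measurable_fun [set: R * R] (fun z : R * R => kern z.1 z.2).
Proof.
have msqrt : measurable_fun [set: R] (@Num.sqrt R).
  by apply: continuous_measurable_fun; exact: sqrt_continuous.
have m1 : measurable_fun [set: R * R] (fun z : R * R => z.1 ^+ 2).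
  by apply: measurable_funX; exact: measurable_fst.
have m2 : measurable_fun [set: R * R] (fun z : R * R => z.2 ^+ 2).
  by apply: measurable_funX; exact: measurable_snd.
apply: measurable_funM; last exact: measurableT_comp measurable_inv m2.
apply: measurable_funM; apply: (measurableT_comp msqrt).
  by apply: measurable_funB => //; exact: measurable_cst.
by apply: measurable_funB => //; apply: measurable_funM => //; exact: measurable_cst.
Qed.

(** The range of [s] moves into the integrand, so that Tonelli's theorem applies over the whole
    plane. *)
Let cut x s : R := \1_(`[0, 2] : set R) s * kern x s.

Let measurable_cut : measurable_fun [set: R * R] (fun z : R * R => cut z.1 z.2).
Proof.
apply: measurable_funM measurable_kern.
apply: (measurableT_comp _ measurable_snd); apply: measurable_indic.
exact: measurable_itv.
Qed.

Let cut_ge0 x s : 0 <= cut x s.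
Proof. by rewrite mulr_ge0 ?kern_ge0// indicE. Qed.

Lemma integral_kern_cut x :
  (\int[mu]_(s in `[0%R, 2%R]) (kern x s)%:E = \int[mu]_s (cut x s)%:E)%E.
Proof.
rewrite integral_mkcond; apply: eq_integral => s _.
by rewrite patchE /cut indicE; case: ifP => _; rewrite ?mul1r ?mul0r.
Qed.

Lemma measurable_integral_kern :
  measurable_fun [set: R] (fun x => \int[mu]_(s in `[0%R, 2%R]) (kern x s)%:E)%E.
Proof.
under eq_fun do rewrite integral_kern_cut.
apply: (@measurable_fun_fubini_tonelli_F _ _ _ (measurableTypeR R) R mu
  (fun z : R * R => (cut z.1 z.2)%:E)).
  exact/measurable_EFinP.
by move=> z; rewrite lee_fin.
Qed.

(** The substitution [x = s t] separates the variables: the factors [s] from the square root and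
    from [dx] cancel [s^2], leaving a semicircle integrand in [s] times one in [t]. *)
Lemma integral_kern_row n s : 0 < s <= 2 ->
  (\int[mu]_(x in `[0%R, 4%R]) (x ^+ (2 * n) * kern x s)%:E
   = ((walks (2 * n) 0)%:R * pi * (s ^+ (2 * n) * Num.sqrt (4 - s ^+ 2)))%:E)%E.
Proof.
move=> /andP[s0 s2].
transitivity (\int[mu]_(x in `[(s * 0)%R, (s * 2)%R]) (x ^+ (2 * n) * kern x s)%:E)%E.
  apply: integral_support; rewrite mulr0.
    by move=> x /=; rewrite !in_itv/=; lra.
  move=> x /=; rewrite !in_itv/= => x04 /negP sx; congr EFin.
  have {}sx : s * 2 < x by lra.
  rewrite /kern (@ler0_sqrtr _ (4 * s ^+ 2 - x ^+ 2)) ?(mulr0, mul0r)//.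
  by nra.
have dF x : is_derive x (1 : R) (fun t => s * t) s.
  by apply: is_derive_eq; rewrite /GRing.scale /=; ring.
have homoF : {in `[0, 2] &, {homo (fun t => s * t) : t u / t < u}}.
  by move=> t u _ _ tu; rewrite ltr_pM2l.
have ck : {within `[s * 0, s * 2], continuous (fun x => x ^+ (2 * n) * kern x s)}.
  apply: continuous_subspaceT => x; apply: cvgM; first exact: exprn_continuous.
  apply: cvgM; last exact: cvg_cst.
  apply: cvgM; first exact: cvg_cst.
  apply: cvg_sqrt_comp; apply: cvgB; first exact: cvg_cst.
  exact: exprn_continuous.
rewrite (integral_subst_increasing _ _ _ _ _ _ homoF dF (fun=> cvg_cst _) ck)//.
transitivity (\int[mu]_(t in `[0%R, 2%R])
    ((s ^+ (2 * n) * Num.sqrt (4 - s ^+ 2))%:E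
     * (t ^+ (2 * n) * Num.sqrt (4 - t ^+ 2))%:E))%E.
  apply: eq_integral => t _; rewrite -EFinM; congr EFin.
  rewrite /kern (_ : 4 * _ - _ = s ^+ 2 * (4 - t ^+ 2)); last by ring.
  rewrite sqrtrM ?sqr_ge0// sqrtr_sqr gtr0_norm// exprMn; field.
  by rewrite gt_eqF.
rewrite integralZl//; last first.
  apply: continuous_compact_integrable; first exact: segment_compact.
  exact/continuous_subspaceT/continuous_semicircle.
by rewrite semicircle_moment -EFinM mulrC.
Qed.

(** After the exchange, the inner integral over [x] gives one semicircle moment and the outer
    integral over [s] the other. *)
Lemma even_moment_kern n :
  (\int[mu]_(x in `[0%R, 4%R])
     ((x ^+ (2 * n))%:E * \int[mu]_(s in `[0%R, 2%R]) (kern x s)%:E)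
   = (((walks (2 * n) 0)%:R * pi) ^+ 2)%:E)%E.
Proof.
pose I x : R := \1_(`[0, 4] : set R) x.
have xn0 x : 0 <= x ^+ (2 * n) by rewrite exprM exprn_ge0 ?sqr_ge0.
pose Phi z : R := I z.1 * (z.1 ^+ (2 * n) * cut z.1 z.2).
have Phi0 z : 0 <= Phi z.
  by rewrite mulr_ge0 ?indicE// mulr_ge0.
have mPhi : measurable_fun [set: R * R] (fun z => (Phi z)%:E).
  apply/measurable_EFinP; apply: measurable_funM.
    apply: (measurableT_comp _ measurable_fst); apply: measurable_indic.
    exact: measurable_itv.
  apply: measurable_funM measurable_cut.
  by apply: measurable_funX; exact: measurable_fst.
have mcut x : measurable_fun [set: R] (fun s => (cut x s)%:E).
  apply/measurable_EFinP.
  exact: (measurableT_comp measurable_cut (measurable_pair1 x)).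
transitivity (\int[mu]_x \int[mu]_s (Phi (x, s))%:E)%E.
  rewrite integral_mkcond; apply: eq_integral => x _.
  rewrite patchE /Phi /I /= indicE; case: ifP => _.
    under [RHS]eq_integral do rewrite mul1r EFinM.
    rewrite ge0_integralZl//; first by rewrite integral_kern_cut.
    - exact: mcut.
    - by move=> s _; rewrite lee_fin.
    - by rewrite lee_fin.
  by under eq_integral do rewrite mul0r; rewrite integral0.
rewrite (@fubini_tonelli _ _ (measurableTypeR R) (measurableTypeR R) R mu mu
  (fun z => (Phi z)%:E))//.
(* The row formula requires [s > 0]; at [s = 0] the kernel is 0 by division by 0, and the endpoint
   is a null set. *)
transitivity (\int[mu]_(s in `]0%R, 2%R]) (((walks (2 * n) 0)%:R * pi)%:E
   * (s ^+ (2 * n) * Num.sqrt (4 - s ^+ 2))%:E))%E; last first.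
  rewrite integral_itv_obnd_cbnd; last first.
    apply: measurable_funTS; apply: emeasurable_funM; first exact: measurable_cst.
    apply/measurable_EFinP; apply: continuous_measurable_fun.
    exact: continuous_semicircle.
  rewrite integralZl//; last first.
    apply: continuous_compact_integrable; first exact: segment_compact.
    exact/continuous_subspaceT/continuous_semicircle.
  by rewrite semicircle_moment -EFinM expr2.
transitivity (\int[mu]_(s in `]0%R, 2%R]) \int[mu]_x (Phi (x, s))%:E)%E.
  apply: integral_support => // s _ /=; rewrite in_itv/= => /negP s02.
  apply: integral0_eq => x _.
  rewrite /Phi /= /cut indicE.
  have [|] := boolP (s \in _); last by rewrite mul0r !mulr0.
  rewrite inE/= in_itv/= => s2; have -> : s = 0 by lra.
  by rewrite /kern expr0n/= invr0 !mulr0.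
apply: eq_integral => s; rewrite inE/= in_itv/= => s02.
rewrite -EFinM -integral_kern_row// [RHS]integral_mkcond.
apply: eq_integral => x _; rewrite patchE /Phi /I /cut /= !indicE.
have -> : s \in `[0%R, 2%R]%classic by rewrite inE/= in_itv/=; lra.
by case: ifP => _; rewrite ?mul1r ?mul0r.
Qed.

End tonelli.

(** * The spectral measure *)

Section density_measure.
Context {R : realType}.
Local Notation mu := (@lebesgue_measure R).
Local Notation T := (measurableTypeR R).
Local Open Scope ereal_scope.
Context (p : T -> \bar R) (mp : measurable_fun [set: T] p)
  (p0 : forall x, 0 <= p x) (p1 : \int[mu]_x p x = 1).

(** Carrying the three properties as arguments lets the measure and probability structures be
    attached to this function. *)
Definition density_measure of measurable_fun [set: T] p & (forall x, 0 <= p x)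
    & \int[mu]_x p x = 1 : set T -> \bar R :=
  fun A => \int[mu]_(x in A) p x.

Local Notation nu := (density_measure mp p0 p1).

Let nu_set0 : nu set0 = 0.
Proof. exact: integral_set0. Qed.

Let nu_ge0 A : 0 <= nu A.
Proof. by apply: integral_ge0 => x _. Qed.

Let nu_sigma_additive : semi_sigma_additive nu.
Proof.
move=> /= F mF tF mUF; rewrite /density_measure; apply: cvg_toP.
  apply: ereal_nondecreasing_is_cvgn => m n mn.
  by apply: lee_sum_nneg_natr => // k _ _; apply: integral_ge0.
by rewrite ge0_integral_bigcup//=; exact: measurable_funTS.
Qed.

HB.instance Definition _ := isMeasure.Build _ _ _ nu
  nu_set0 nu_ge0 nu_sigma_additive.

Let nu_setT : nu [set: T] = 1. Proof. exact: p1. Qed.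

HB.instance Definition _ := @Measure_isProbability.Build _ _ R nu nu_setT.

Lemma density_measure_dominates : nu `<< mu.
Proof.
apply/null_content_dominatesP => A mA A0.
by apply: null_set_integral => //; exact: measurable_funTS.
Qed.

(** [p] and the Radon-Nikodym derivative have the same integral over every measurable set, so they
    agree almost everywhere. *)
Lemma integral_density_measure (f : T -> \bar R) : nu.-integrable [set: T] f ->
  \int[nu]_x f x = \int[mu]_x (f x * p x).
Proof.
move=> intf.
rewrite -(Radon_Nikodym_change_of_variables density_measure_dominates)//.
have mf : measurable_fun [set: T] f by exact: measurable_int intf.
apply: ae_eq_integral => //.
- apply: emeasurable_funM => //; apply: (measurable_int mu).
  apply: Radon_Nikodym_integrable; exact: density_measure_dominates.
- exact: emeasurable_funM.
apply: ae_eqe_mul2l.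
apply: integral_ae_eq => //.
  apply: Radon_Nikodym_integrable; exact: density_measure_dominates.
by move=> A _ mA; rewrite -Radon_Nikodym_integral//; exact: density_measure_dominates.
Qed.

End density_measure.

(** * The density on the whole line, its moments, and uniqueness *)

Section spectral_measure.
Context {R : realType}.
Local Notation mu := (@lebesgue_measure R).
Local Notation T := (measurableTypeR R).
Implicit Types x s t : R.

(** A form of the density that is visibly nonnegative and measurable on the whole line. It agrees
    with [density] on [[-4, 4]] except at 0, where this integral is infinite while [density] is 0 by
    division by 0. *)
Definition edensity x : \bar R :=
  ((1 / (2 * pi ^+ 2))%:E * \int[mu]_(s in `[0%R, 2%R]) (kern x s)%:E)%E.

Let c_ge0 : 0 <= 1 / (2 * pi ^+ 2) :> R.
Proof. by rewrite divr_ge0// mulr_ge0 ?sqr_ge0. Qed.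

Lemma edensity_ge0 x : (0 <= edensity x)%E.
Proof.
apply: mule_ge0; first by rewrite lee_fin.
by apply: integral_ge0 => s _; rewrite lee_fin kern_ge0.
Qed.

Lemma edensityN x : edensity (- x) = edensity x.
Proof. by rewrite /edensity; under eq_integral do rewrite kernN. Qed.

Lemma measurable_edensity : measurable_fun [set: R] edensity.
Proof.
by apply: emeasurable_funM; [exact: measurable_cst|exact: measurable_integral_kern].
Qed.

Lemma edensity_eq0 x : 4 <= `|x| -> edensity x = 0%E.
Proof.
move=> x4; rewrite /edensity integral0_eq ?mule0// => s _; congr EFin.
have x16 : 16 <= x ^+ 2 by rewrite -(real_normK (num_real x)); nra.
rewrite /kern; have [s4|s4] := lerP (s ^+ 2) 4.
  by rewrite (@ler0_sqrtr _ (4 * s ^+ 2 - x ^+ 2)) ?(mulr0, mul0r)//; lra.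
by rewrite ler0_sqrtr ?mul0r//; lra.
Qed.

Lemma densityN x : density (- x) = density x.
Proof. by rewrite /density normrN sqrrN. Qed.

(** The substitutions need [x < 4]. At the endpoint the parameter is 0, so K and E coincide, and
    their coefficients [x^2 + 16] and [2 x^2] are equal. *)
Lemma density4 : density 4 = 0 :> R.
Proof.
rewrite /density (_ : 4 ^+ 2 - 16 = 0) ?mul0r; last by ring.
have -> : ellipticK 0 = ellipticE 0 :> R.
  by apply: eq_Rintegral => t _; rewrite mul0r subr0 sqrtr1 invr1.
by rewrite (_ : 4 ^+ 2 + 16 = 2 * 4 ^+ 2) ?subrr ?mulr0//; ring.
Qed.

Lemma EFin_density x : x \in `[-4, 4] -> x != 0 -> (density x)%:E = edensity x.
Proof.
wlog x0 : x / 0 < x => [H x4 xn0|].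
  have [x0|x0|] := ltgtP 0 x; [exact: H| |by move/eqP; rewrite eq_sym (negbTE xn0)].
  rewrite -densityN -edensityN; apply: H; rewrite ?oppr_eq0 ?oppr_gt0//.
  by move: x4; rewrite !in_itv/=; lra.
rewrite in_itv/= => /andP[_]; rewrite le_eqVlt => /predU1P[-> _|x4 _].
  by rewrite density4 edensity_eq0// ger0_norm.
by apply: density_kern; rewrite x0.
Qed.

Lemma integral_density A : measurable (A : set T) ->
  (\int[mu]_(x in A `&` `[(-4)%R, 4%R]) (density x)%:E
   = \int[mu]_(x in A) edensity x)%E.
Proof.
move=> mA; set D := A `&` `[(-4)%R, 4%R].
have mD : measurable D by apply: measurableI => //; exact: measurable_itv.
(* The two densities may differ at 0, a null set. *)
pose D0 : set T := D `\ 0.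
have mD0 : measurable D0 by exact: measurableD.
have eqD x : D0 x -> (density x)%:E = edensity x.
  by move=> [[_ x4] /eqP x0]; exact: EFin_density.
have md : measurable_fun D0 (fun x => (density x)%:E).
  apply: (eq_measurable_fun edensity) => [x|].
    by rewrite inE => /eqD.
  exact: measurable_funTS measurable_edensity.
transitivity (\int[mu]_(x in D0) (density x)%:E)%E.
  by apply/esym/integral_setD1.
transitivity (\int[mu]_(x in D0) edensity x)%E.
  by apply: eq_integral => x; rewrite inE => /eqD.
transitivity (\int[mu]_(x in D) edensity x)%E.
  by apply: integral_setD1 => //; exact: measurable_funTS measurable_edensity.
apply/esym; apply: integral_support => [x []//|x Ax] nD.
apply: edensity_eq0; rewrite leNgt; apply/negP => x4; apply: nD; split => //=.
by move: x4; rewrite ltr_norml in_itv/=; lra.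
Qed.

Lemma edensity_even_moment n :
  (\int[mu]_x ((x ^+ (2 * n))%:E * edensity x) = ((walks (2 * n) 0 ^ 2)%N%:R)%:E)%E.
Proof.
pose f x := ((x ^+ (2 * n))%:E * edensity x)%E.
have f0 x : (0 <= f x)%E.
  by apply: mule_ge0 (edensity_ge0 x); rewrite lee_fin exprM exprn_ge0 ?sqr_ge0.
have mf : measurable_fun [set: R] f.
  apply: emeasurable_funM measurable_edensity.
  by apply/measurable_EFinP; apply: measurable_funX; exact: measurable_id.
transitivity (\int[mu]_(x in `[(-4)%R, 4%R]) f x)%E.
  apply: integral_support => // x _ /=; rewrite in_itv/= => /negP x4.
  by rewrite /f edensity_eq0 ?mule0// leNgt ltr_norml; apply/negP; lra.
rewrite ge0_integral_even//; last first.
  by move=> x; rewrite /f edensityN exprM sqrrN -exprM.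
rewrite (_ : \int[mu]_(x in _) _ = (1 / (2 * pi ^+ 2))%:E
   * \int[mu]_(x in `[0%R, 4%R])
       ((x ^+ (2 * n))%:E * \int[mu]_(s in `[0%R, 2%R]) (kern x s)%:E))%E; last first.
  rewrite -ge0_integralZl//.
  - by apply: eq_integral => x _; rewrite /f /edensity muleCA.
  - apply: measurable_funTS; apply: emeasurable_funM measurable_integral_kern.
    by apply/measurable_EFinP; apply: measurable_funX; exact: measurable_id.
  - move=> x _; apply: mule_ge0; first by rewrite lee_fin exprM exprn_ge0 ?sqr_ge0.
    by apply: integral_ge0 => s _; rewrite lee_fin kern_ge0.
(* The constants cancel: 2 from evenness, [1 / (2 pi^2)] from [edensity], and [pi^2] from the two
   semicircle moments. *)
rewrite even_moment_kern -!EFinM natrX; congr EFin.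
have : pi != 0 :> R by rewrite gt_eqF// pi_gt0.
by move: (@pi R) => p p0; field.
Qed.

(** The total mass is the zeroth moment, and [walks 0 0] is 1. *)
Lemma integral_edensity : (\int[mu]_x edensity x = 1)%E.
Proof.
rewrite -[RHS](edensity_even_moment 0); apply: eq_integral => x _.
by rewrite muln0 expr0 mul1e.
Qed.

Definition spectral_density : probability T R :=
  @density_measure R edensity measurable_edensity edensity_ge0 integral_edensity.

Lemma spectral_densityE A : measurable (A : set T) -> spectral_density A =
  (\int[mu]_(x in A `&` `[(-4)%R, 4%R]) (density x)%:E)%E.
Proof. by move=> mA; rewrite integral_density. Qed.

Lemma spectral_density_support : spectral_density (~` `[-4, 4]) = 0%E.
Proof.
apply: integral0_eq => x /=; rewrite in_itv/= => /negP x4.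
by rewrite edensity_eq0// leNgt ltr_norml; apply/negP; lra.
Qed.

(** Odd moments vanish on both sides: the density is even, and a closed walk has even length. *)
Lemma spectral_density_moment m :
  \int[spectral_density]_t t ^+ m = (walks m 0 ^ 2)%N%:R :> R.
Proof.
have int : spectral_density.-integrable [set: T] (fun t => (t ^+ m)%:E).
  have := @integrable_horner R spectral_density 4 'X^m spectral_density_support.
  by apply: eq_integrable => // t _; rewrite hornerXn.
rewrite /Rintegral integral_density_measure//.
have [n mn] : exists n, m = (2 * n + odd m)%N.
  by exists m./2; rewrite mul2n addnC odd_double_half.
have [modd|meven] := boolP (odd m); last first.
  by rewrite mn (negbTE meven) addn0 edensity_even_moment.
rewrite walks_odd ?addn0//.
pose f x := ((x ^+ m)%:E * edensity x)%E.
have mf : measurable_fun [set: R] f.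
  apply: emeasurable_funM measurable_edensity.
  by apply/measurable_EFinP; apply: measurable_funX; exact: measurable_id.
have fN : f \o -%R = (\- f)%E.
  apply/funext => x /=; rewrite /f edensityN exprNn -signr_odd modd expr1.
  by rewrite mulN1r EFinN mulNe.
have -> : (\int[mu]_x ((x ^+ m)%:E * edensity x)
    = \int[mu]_(x in `[(-4)%R, 4%R]) f x)%E.
  apply: integral_support => // x _ /=; rewrite in_itv/= => /negP x4.
  by rewrite /f edensity_eq0 ?mule0// leNgt ltr_norml; apply/negP; lra.
(* As [f] is odd, reflection carries its positive part to its negative part. *)
have -> : (\int[mu]_(x in `[(-4)%R, 4%R]) f x
    = \int[mu]_(x in `[(-4)%R, 4%R]) f^\- x
      - \int[mu]_(x in `[(-4)%R, 4%R]) f^\- x)%E.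
  rewrite integralE ge0_integral_reflect//; last exact: measurable_funepos.
  rewrite opprK; congr (_ - _)%E; apply: eq_integral => x _.
  by have -> : (f^\- = f^\+ \o -%R)%E by rewrite -funeposN -fN funepos_comp.
(* The difference is 0, or the junk value [+oo - +oo = -oo], with [fine -oo = 0]. *)
by case: (\int[mu]_(x in _) _)%E => [r||] //=; rewrite subrr.
Qed.

Lemma is_spectral_measure_density : is_spectral_measure spectral_density.
Proof.
split.
  exists `[-4, 4]%classic; first exact: segment_compact.
  exact: spectral_density_support.
by move=> m; rewrite spectral_moment spectral_density_moment.
Qed.

(** Both compact carriers fit in one segment [[-M, M]], and both sequences of moments are the real
    parts of the same inner products, so [moments_unique] applies. *)
Lemma is_spectral_measure_unique (nu1 nu2 : probability T R) :
  is_spectral_measure nu1 -> is_spectral_measure nu2 ->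
  forall A, measurable A -> nu1 A = nu2 A.
Proof.
move=> [[K1 cK1 K10] m1] [[K2 cK2 K20] m2].
have [M1 K1M] : exists M : R, K1 `<=` `[- M, M].
  have [M [Mr HM]] := compact_bounded cK1; exists (M + 1) => x K1x.
  by rewrite /= in_itv/= -ler_norml; apply: HM K1x; rewrite ltrDl.
have [M2 K2M] : exists M : R, K2 `<=` `[- M, M].
  have [M [Mr HM]] := compact_bounded cK2; exists (M + 1) => x K2x.
  by rewrite /= in_itv/= -ler_norml; apply: HM K2x; rewrite ltrDl.
pose M := Num.max M1 M2.
have null (nu : probability T R) K N : measurable (K : set T) -> N <= M ->
    K `<=` `[- N, N] -> nu (~` K) = 0%E -> nu (~` `[- M, M]) = 0%E.
  move=> mK NM KN nuK; apply/eqP; rewrite eq_le measure_ge0 andbT -nuK.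
  apply: le_measure; rewrite ?inE; [|exact: measurableC|].
    by apply: measurableC; exact: measurable_itv.
  by apply: subsetC => x /KN /=; rewrite !in_itv/=; lra.
apply: (@moments_unique R nu1 nu2 M).
- by apply: null K1M K10; [exact: compact_measurable|rewrite le_max lexx].
- by apply: null K2M K20; [exact: compact_measurable|rewrite le_max lexx orbT].
- by move=> m; exact: (congr1 (@complex.Re R) (etrans (esym (m1 m)) (m2 m))).
Qed.

End spectral_measure.

Theorem theorem8p7 (R : realType) :
  [/\ @chi_rho1 R @` torus2 = (fun x : R => x%:C%C) @` `[-4, 4],
      exists nu : probability (measurableTypeR R) R, is_spectral_measure nu &
      forall nu : probability (measurableTypeR R) R, is_spectral_measure nu ->
        forall A : set (measurableTypeR R), measurable A ->
        nu A = (\int[lebesgue_measure]_(x in (A `&` `[(-4)%R, 4%R]))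
          (1 / (2 * pi ^+ 2 * `|x|) *
            ((x ^+ 2 + 16) * ellipticK ((x ^+ 2 - 16) / x ^+ 2)
             - 2 * x ^+ 2 * ellipticE ((x ^+ 2 - 16) / x ^+ 2))%R)%:E)%E].
Proof.
split; first exact: chi_rho1_image.
  exists spectral_density; exact: is_spectral_measure_density.
move=> nu nuP A mA; rewrite -spectral_densityE//.
exact: is_spectral_measure_unique nuP is_spectral_measure_density A mA.
Qed.
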